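(* Let $\phi(x)=\sum_{n=0}^\infty\alpha_n x^n$ be a formal power series with real coefficients. Then the following are equivalent: (i) for every real polynomial $f$ there is a positive integer $m_0$ such that $\phi(D)^m f$ has only real zeros (i.e. $Z_C(\phi(D)^m f)=0$) whenever $m\ge m_0$; (ii) $\alpha_0=0$ or $2\alpha_0\alpha_2-\alpha_1^2<0$.
   Context: $D$ denotes differentiation. For a formal power series $\phi(x)=\sum\alpha_n x^n$ (not assumed convergent) and a polynomial $f$, $\phi(D)f=\sum_{n\ge 0}\alpha_n f^{(n)}$ (a finite sum), and $\phi(D)^m f$ denotes the $m$-fold application of $\phi(D)$ to $f$. For a real polynomial $g$, $Z_C(g)$ denotes the number of nonreal zeros of $g$ counted with multiplicity, with the convention $Z_C(g)=0$ if $g$ is identically $0$. *)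

(* Defs.v *)
From HB Require Import structures.
From mathcomp Require Import all_boot all_order all_algebra.
From mathcomp Require Import reals.
From mathcomp Require Import complex.
Set Implicit Arguments.
Unset Strict Implicit.
Unset Printing Implicit Defensive.
Import GRing.Theory Num.Theory.
Local Open Scope ring_scope.

(* The formal power series sum_n alpha n * x^n is its coefficient sequence
   alpha.  The sum below stops at size f because f^`(n) = 0 for n >= size f. *)
Definition phiD (R : realType) (alpha : nat -> R) (f : {poly R}) : {poly R} :=
  \sum_(n < size f) alpha n *: f^`(n).

(* For p != 0, the sequence r provided by closed_field_poly_normal satisfies
   p = lead_coef p *: \prod_(z <- r) ('X - z%:P), so it lists the zeros of p
   with multiplicity, uniquely up to permutation.  For p = 0 that equation
   says nothing about r. *)
Definition czeros (R : realType) (g : {poly R}) : seq R[i] :=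
  sval (closed_field_poly_normal (map_poly (real_complex R) g)).

Definition ZC (R : realType) (g : {poly R}) : nat :=
  if g == 0 then 0%N else count (fun z => complex.Im z != 0) (czeros g).

(* Main.v *)
Require Import Defs.
From mathcomp Require Import all_boot all_order all_algebra.
From mathcomp Require Import reals complex.
From mathcomp Require Import boolp polyrcf ring lra zify.
Import Order.TTheory.
Import GRing.Theory Num.Theory.
Local Open Scope ring_scope.

(* If alpha_0 <> 0 and 2 alpha_0 alpha_2 < alpha_1^2, normalise phi to
   alpha_0^-1 exp(-(alpha_1/alpha_0) x) phi(x) = 1 + b x^2 + ... with b < 0;
   this only rescales and translates phi(D)^m f.  With s = sqrt m and n the
   degree of f, s^-n (phi(D)^m f)(s y) is a polynomial in 1/s whose value at
   1/s = 0 is a multiple of exp(b D^2) y^n, a Hermite polynomial with n simple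
   real zeros.  Its sign changes survive for small 1/s, so phi(D)^m f has n
   real zeros.  Conversely, if alpha_0 <> 0 and 2 alpha_0 alpha_2 >= alpha_1^2,
   then phi(D) maps quadratics with negative discriminant to such quadratics,
   so every phi(D)^m (x^2 + 1) has nonreal zeros. *)

Set Implicit Arguments.
Unset Strict Implicit.
Unset Printing Implicit Defensive.

(** * Sign alternation forces real-rootedness *)

(** Strict sign changes at fixed points are used, rather than roots, because they survive small
    perturbations of [p]. *)
Definition alternating (R : realType) (p : {poly R}) (n : nat) (y : nat -> R) :=
  forall i, (i < n)%N -> y i < y i.+1 /\ p.[y i] * p.[y i.+1] < 0.

Lemma alternating_roots (R : realType) (p : {poly R}) n y :
  alternating p n y ->
  exists r : nat -> R,
    forall i, (i < n)%N -> y i < r i < y i.+1 /\ root p (r i).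
Proof.
move=> alt.
suff /choice[r rP] : forall i, exists x, (i < n)%N ->
    y i < x < y i.+1 /\ root p x by exists r.
move=> i; case: (ltnP i n) => [ltin|_]; last by exists 0.
have [lty ltp] := alt _ ltin.
have [x] := poly_ivtoo (ltW lty) ltp.
by rewrite in_itv /= => xP px; exists x.
Qed.

Lemma alternating_le (R : realType) (p : {poly R}) n y i j :
  alternating p n y -> (i <= j <= n)%N -> y i <= y j.
Proof.
move=> alt /andP[/subnK <-]; elim: (j - i)%N => [|k IH] //= ltk.
by have [/ltW + _] := alt _ ltk; apply: le_trans; apply: IH; apply: ltnW.
Qed.

Lemma alternating_roots_lt (R : realType) (p : {poly R}) n y (r : nat -> R) :
    alternating p n y ->
    (forall i, (i < n)%N -> y i < r i < y i.+1 /\ root p (r i)) ->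
  forall i j, (i < j < n)%N -> r i < r j.
Proof.
move=> alt rP i j /andP[ltij ltjn].
have [/andP[_ r1] _] := rP _ (ltn_trans ltij ltjn).
have [/andP[r2 _] _] := rP _ ltjn.
apply: lt_trans r1 (le_lt_trans _ r2).
by apply: (alternating_le alt); rewrite ltij ltnW.
Qed.

(** The intervals are disjoint, so the [r i] are [n] distinct roots; the size bound leaves room for
    no others. *)
Lemma alternating_factor (R : realType) (p : {poly R}) n y (r : nat -> R) :
    p != 0 -> (size p <= n.+1)%N -> alternating p n y ->
    (forall i, (i < n)%N -> y i < r i < y i.+1 /\ root p (r i)) ->
  p = lead_coef p *: \prod_(i < n) ('X - (r i)%:P).
Proof.
move=> p_neq0 sz_p alt rP.
have r_inc := alternating_roots_lt alt rP.
have uniq_r : uniq (mkseq r n).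
  apply/mkseq_uniqP => i j; rewrite !inE => lti ltj eqr.
  case: (ltngtP i j) => // ltij; last first.
    by have := r_inc j i; rewrite ltij lti eqr ltxx => /(_ isT).
  by have := r_inc i j; rewrite ltij ltj eqr ltxx => /(_ isT).
have root_r : all (root p) (mkseq r n).
  by apply/allP => _ /mapP[i + ->]; rewrite mem_iota => /rP[].
have sz_eq : size p = n.+1.
  apply/eqP; rewrite eqn_leq sz_p /=.
  by have := max_poly_roots p_neq0 root_r uniq_r; rewrite size_mkseq.
rewrite {1}(@all_roots_prod_XsubC _ p (mkseq r n)) ?size_mkseq ?uniq_rootsE //.
by rewrite big_map -(big_mkord xpredT (fun i => 'X - (r i)%:P)) /index_iota subn0.
Qed.

Lemma root_czeros (R : realType) (g : {poly R}) z :
  g != 0 -> (z \in czeros g) = root (map_poly (real_complex R) g) z.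
Proof.
move=> g_neq0; rewrite /czeros; case: closed_field_poly_normal => s /= ->.
rewrite rootZ ?root_prod_XsubC // lead_coef_eq0.
by rewrite map_poly_eq0.
Qed.

Lemma ZC_alternating (R : realType) (p : {poly R}) n y :
  (size p <= n.+1)%N -> alternating p n y -> ZC p = 0%N.
Proof.
move=> sz_p alt; rewrite /ZC; case: eqVneq => // p_neq0.
have [r rP] := alternating_roots alt.
apply/eqP; rewrite -leqn0 leqNgt -has_count; apply/hasPn => z.
rewrite root_czeros // (alternating_factor p_neq0 sz_p alt rP).
rewrite map_polyZ rmorph_prod /= rootZ; last by rewrite fmorph_eq0 lead_coef_eq0.
rewrite /root horner_prod prodf_seq_eq0 => /hasP[i _ /=].
rewrite rmorphB /= map_polyX map_polyC hornerXsubC subr_eq0 => /eqP ->.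
by rewrite /= eqxx.
Qed.

(** * Hermite polynomials and the interlacing of their roots *)

Lemma deriv_prod_root (R : comNzRingType) n (r : nat -> R) k : (k < n)%N ->
  (\prod_(i < n) ('X - (r i)%:P))^`().[r k]
    = \prod_(i < n | i != k :> nat) (r k - r i).
Proof.
move=> ltkn; rewrite (bigD1 (Ordinal ltkn)) //= derivM hornerD !hornerM.
rewrite hornerXsubC subrr mul0r addr0 derivXsubC hornerC mul1r horner_prod.
by apply: eq_bigr => i _; rewrite hornerXsubC.
Qed.

(* The hypothesis says that no other root lies between [x] and [r k], so only
   the factor ['X - (r k)%:P] contributes to the sign of the product. *)
Lemma sign_prod_deriv (R : realFieldType) n (r : nat -> R) k x : (k < n)%N ->
    (forall i, (i < n)%N -> i != k -> 0 < (x - r i) * (r k - r i)) ->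
  let q := \prod_(i < n) ('X - (r i)%:P) in
  exists2 c : R, 0 < c & q.[x] * q^`().[r k] = (x - r k) * c.
Proof.
move=> ltkn pos q; rewrite /q deriv_prod_root // horner_prod.
exists (\prod_(i < n | i != k :> nat) ((x - r i) * (r k - r i))).
  by apply: prodr_gt0 => i neik; apply: pos.
rewrite (bigD1 (Ordinal ltkn)) //= hornerXsubC -mulrA big_split /=.
by congr (_ * (_ * _)); apply: eq_bigr => i _; rewrite hornerXsubC.
Qed.

Lemma monic_pinfty_gt0 (R : realType) (p : {poly R}) b :
  p \is monic -> exists2 x : R, b < x & 0 < p.[x].
Proof.
move=> /monicP p_monic; have [|c cP] := @poly_pinfty_gt_lc _ p; first by lra.
exists (Num.max c (b + 1)).
  by apply: (@lt_le_trans _ _ (b + 1)); [lra | rewrite le_max lexx orbT].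
by apply: lt_le_trans (cP _ _); rewrite ?p_monic // le_max lexx.
Qed.

(** In odd degree [-p(-x)] is again monic, so the behaviour at plus infinity applies to it. *)
Lemma monic_odd_ninfty_lt0 (R : realType) (p : {poly R}) b :
  p \is monic -> odd (size p).-1 -> exists2 x : R, x < b & p.[x] < 0.
Proof.
move=> p_monic p_odd; have [|x ltbx] := @monic_pinfty_gt0 _ (- (p \Po (- 'X))) (- b).
  rewrite monicE lead_coefN lead_coef_comp ?size_polyN ?size_polyX //.
  by rewrite (monicP p_monic) lead_coefN lead_coefX -signr_odd p_odd mul1r opprK.
rewrite hornerN horner_comp hornerN hornerX => ?; exists (- x); lra.
Qed.

(* [hermite b n] is exp(b D^2) x^n, see [hermiteE]; it is a rescaled Hermite
   polynomial when [b < 0]. *)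
Fixpoint hermite (R : nzRingType) (b : R) (n : nat) : {poly R} :=
  if n is n'.+1 then 'X * hermite b n' + (b *+ 2) *: (hermite b n')^`() else 1.

Lemma size_monic_hermite (R : idomainType) (b : R) n :
  (size (hermite b n) == n.+1) && (hermite b n \is monic).
Proof.
elim: n => [|n /andP[/eqP IHs IHm]] /=; first by rewrite size_poly1 monic1 eqxx.
have szX : size ('X * hermite b n) = n.+2.
  by rewrite mulrC size_mulX ?IHs // -size_poly_eq0 IHs.
have szD : (size ((b *+ 2) *: (hermite b n)^`()) < size ('X * hermite b n)%R)%N.
  rewrite szX ltnS; apply: leq_trans (size_scale_leq _ _) _.
  by rewrite -IHs ltnW // lt_size_deriv // monic_neq0.
rewrite size_polyDl // szX eqxx /= monicE lead_coefDl // mulrC lead_coefMX.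
by rewrite -monicE.
Qed.

Lemma size_hermite (R : idomainType) (b : R) n : size (hermite b n) = n.+1.
Proof. by have /andP[/eqP] := size_monic_hermite b n. Qed.

Lemma monic_hermite (R : idomainType) (b : R) n : hermite b n \is monic.
Proof. by have /andP[] := size_monic_hermite b n. Qed.

Lemma derivnMX (R : comNzRingType) (p : {poly R}) k :
  ('X * p)^`(k) = 'X * p^`(k) + p^`(k.-1) *+ k.
Proof.
case: k => [|k]; first by rewrite !derivn0 mulr0n addr0.
by have := derivnMXaddC k p 0; rewrite addr0 mulrC => ->; rewrite mulrC addrC.
Qed.

(** Induction through the commutation rule exp(b D^2) x = x exp(b D^2) + 2 b D exp(b D^2), read off
    termwise from Leibniz's rule. *)
Lemma hermiteE (R : fieldType) (b : R) n : (forall k, k.+1%:R != 0 :> R) ->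
  hermite b n = \sum_(j < n.+1) (b ^+ j / j`!%:R) *: ('X^n)^`(j.*2).
Proof.
move=> char0; elim: n => [|n IH].
  by rewrite big_ord1 /= !expr0 divr1 scale1r.
rewrite /= {}IH.
under [RHS]eq_bigr => j _ do rewrite exprS derivnMX scalerDr.
rewrite big_split /=; congr (_ + _).
  have Xn0 : ('X^n : {poly R})^`(n.+1.*2) = 0.
    by rewrite derivn_poly0 // size_polyXn -addnn leq_addr.
  rewrite [RHS]big_ord_recr [X in _ = _ + X](_ : _ = 0) ?addr0; last first.
    by rewrite /= in Xn0 *; rewrite Xn0 mulr0 scaler0.
  by rewrite mulr_sumr; apply: eq_bigr => j _; rewrite -scalerAr.
rewrite [RHS]big_ord_recl /= mulr0n scaler0 add0r raddf_sum /= scaler_sumr.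
apply: eq_bigr => j _.
rewrite linearZ /= scalerA /bump add1n /= -derivnS -scaler_nat scalerA.
congr (_ *: _); rewrite factS natrM exprS invfM -muln2 natrM mulr_natr.
rewrite -[b *+ 2]mulr_natr.
have fj : j`!%:R != 0 :> R by have := char0 (j`!).-1; rewrite prednK ?fact_gt0.
by have := char0 j; rewrite -natr1 addrC => cj; field; rewrite cj fj.
Qed.

Lemma mulr_gt0_common (R : realFieldType) (a b c : R) :
  0 < (b * a) * (b * c) -> 0 < a * c.
Proof.
rewrite mulrACA => h; rewrite ltNge; apply: contraTN h => ac.
by rewrite -leNgt mulr_ge0_le0 // -expr2 sqr_ge0.
Qed.

Lemma mulr_lt0_common (R : realFieldType) (a b c : R) :
  (b * a) * (b * c) < 0 -> a * c < 0.
Proof.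
rewrite -oppr_gt0 -2!mulrN => /mulr_gt0_common.
by rewrite mulrN oppr_gt0.
Qed.

(** At a root [r] of H_n the recurrence gives H_(n+1)(r) = 2 b H_n'(r), and H_n' changes sign
    between consecutive simple roots. So H_(n+1) alternates along the roots of H_n, with one more
    sign change at each end because [b < 0]. *)
Lemma alternating_hermite (R : realType) (b : R) n : b < 0 ->
  exists y : nat -> R, alternating (hermite b n) n y.
Proof.
move=> b_lt0; elim: n => [|n [y alt_y]]; first by exists (fun=> 0) => i.
have H_neq0 := monic_neq0 (monic_hermite b n).
have [r rP] := alternating_roots alt_y.
have r_inc := alternating_roots_lt alt_y rP.
have Hprod : hermite b n = \prod_(i < n) ('X - (r i)%:P).
  rewrite {1}(alternating_factor H_neq0 _ alt_y rP) ?size_hermite //.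
  by rewrite (monicP (monic_hermite b n)) scale1r.
have HSr i : (i < n)%N ->
    (hermite b n.+1).[r i] = b *+ 2 * (hermite b n)^`().[r i].
  move=> /rP[_ /rootP ri].
  by rewrite /= hornerD hornerM ri mulr0 add0r hornerZ.
have signr k x : (k < n)%N -> (forall i, (i < k)%N -> r i < x) ->
    (forall i, (k < i < n)%N -> x < r i) ->
    exists2 c : R, 0 < c & (hermite b n).[x] * (hermite b n)^`().[r k] = (x - r k) * c.
  move=> ltkn lo hi; rewrite Hprod; apply: sign_prod_deriv => // i ltin.
  rewrite neq_ltn => /orP[ltik|ltki].
    by rewrite mulr_gt0 // subr_gt0 ?lo // r_inc // ltik.
  by rewrite nmulr_rgt0 subr_lt0 ?hi ?r_inc ?ltki.
(* The product has odd degree 2n+1, so H_n and H_(n+1) have opposite signs far left and equal signs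
   far right, whatever the parity of [n]. *)
have monicHH : hermite b n * hermite b n.+1 \is monic.
  by rewrite rpredM // monic_hermite.
have oddHH : odd (size (hermite b n * hermite b n.+1)%R).-1.
  rewrite size_mul ?monic_neq0 ?monic_hermite // !size_hermite.
  by rewrite addSn addnS /= oddD /= addbN addbb.
(* Comparing with 0 as well ensures [lo < hi] when [n = 0] and there are no roots. *)
have [lo ltlo lo_lt0] := monic_odd_ninfty_lt0 (Num.min 0 (r 0%N)) monicHH oddHH.
have [hi lthi hi_gt0] := monic_pinfty_gt0 (Num.max 0 (r n.-1)) monicHH.
move: ltlo lthi; rewrite lt_min gt_max => /andP[lo0 ltlo] /andP[hi0 lthi].
rewrite !hornerM in lo_lt0 hi_gt0.
have r_mono i j : (i <= j)%N -> (j < n)%N -> r i <= r j.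
  rewrite leq_eqVlt => /predU1P[-> //|ltij] ltj.
  by rewrite ltW // r_inc // ltij.
have b2_lt0 : b *+ 2 < 0 by rewrite mulrn_wlt0.
pose z i := if i is i'.+1 then (if (i' < n)%N then r i' else hi) else lo.
exists z => -[_|i]; last rewrite ltnS => lti.
  rewrite /z; case: (posnP n) => [n0|n_gt0].
    rewrite (lt_trans lo0 hi0); split=> //; move: lo_lt0 hi_gt0.
    by rewrite n0 [hermite _ 0]/= !hornerC !mul1r => lo_lt0 hi_gt0; rewrite nmulr_rlt0.
  split=> //; rewrite HSr //.
  have [//|i|c c_gt0 Hc] := signr 0%N lo n_gt0.
    by move=> /andP[_ lti]; apply: lt_le_trans ltlo (r_mono _ _ _ lti).
  rewrite mulrCA nmulr_rlt0 //; apply: (@mulr_gt0_common _ _ (hermite b n).[lo]).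
  by rewrite nmulr_rgt0 // Hc pmulr_llt0 // subr_lt0.
rewrite /z lti; case: ifP => [lti1|/negbT].
  split; first by rewrite r_inc // ltnS lti1 leqnn.
  rewrite !HSr // mulrACA pmulr_rlt0; last by rewrite nmulr_rgt0.
  (* The old alternation point [y i.+1] separates the two roots; the value of H_n there is the
     common factor against which both derivative signs are read. *)
  have mid1 : r i < y i.+1 by have [/andP[]] := rP _ lti.
  have mid2 : y i.+1 < r i.+1 by have [/andP[]] := rP _ lti1.
  have [j ltji|j /andP[ltij ltjn]|c c_gt0 Hc] := signr _ (y i.+1) lti.
  - by apply: lt_trans mid1; rewrite r_inc // ltji.
  - by apply: lt_le_trans mid2 (r_mono _ _ _ _).
  have [j|j /andP[ltij ltjn]|c' c'_gt0 Hc'] := signr _ (y i.+1) lti1.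
  - by rewrite ltnS => leji; apply: le_lt_trans mid1; apply: r_mono.
  - by apply: lt_trans mid2 _; rewrite r_inc // ltij.
  apply: (@mulr_lt0_common _ _ (hermite b n).[y i.+1]).
  rewrite Hc Hc' mulrACA pmulr_llt0 ?mulr_gt0 //.
  by rewrite pmulr_rlt0 ?subr_gt0 // subr_lt0.
rewrite -leqNgt => len; have ein : n.-1 = i by lia.
rewrite ein in lthi; split=> //; rewrite HSr // -mulrA nmulr_rlt0 //.
have [j ltji|j|c c_gt0 Hc] := signr _ hi lti.
- by apply: le_lt_trans lthi; rewrite r_mono // ltnW.
- by move=> /andP[ltij ltjn]; lia.
apply: (@mulr_gt0_common _ _ (hermite b n).[hi]).
by rewrite Hc mulr_gt0 // mulr_gt0 // subr_gt0.
Qed.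

(** * Differential operators with polynomial symbols *)

Lemma sum_ord_support (V : nmodType) (F : nat -> V) a b :
    (forall i, (a <= i)%N -> F i = 0) -> (forall i, (b <= i)%N -> F i = 0) ->
  \sum_(i < a) F i = \sum_(i < b) F i.
Proof.
wlog leab : a b / (a <= b)%N.
  by move=> W Fa Fb; case/orP: (leq_total a b) => leab; [|symmetry]; apply: W.
move=> Fa _; rewrite (big_ord_widen_cond b xpredT F) //= big_mkcond.
by apply: eq_bigr => i _; case: ifPn => //; rewrite -leqNgt => /Fa.
Qed.

Section DiffOp.
Variable R : comNzRingType.
Implicit Types (A B f : {poly R}).

(** This is A(D). A polynomial symbol suffices, since a power series acts on bounded degree through
    a truncation. *)
Definition diffop A f := \sum_(i < size A) A`_i *: f^`(i).

Lemma diffopE N A f : (size A <= N)%N -> diffop A f = \sum_(i < N) A`_i *: f^`(i).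
Proof.
move=> szA; apply: (sum_ord_support (F := fun i => A`_i *: f^`(i))) => i lei.
  by rewrite nth_default ?scale0r.
by rewrite nth_default ?scale0r // (leq_trans szA).
Qed.

Lemma diffop0 f : diffop 0 f = 0.
Proof. by rewrite /diffop size_poly0 big_ord0. Qed.

Lemma diffopD A B f : diffop (A + B) f = diffop A f + diffop B f.
Proof.
pose N := maxn (size A) (size B).
rewrite !(@diffopE N) ?size_polyD ?leq_maxl ?leq_maxr // -big_split /=.
by apply: eq_bigr => i _; rewrite coefD scalerDl.
Qed.

Lemma diffopZ c A f : diffop (c *: A) f = c *: diffop A f.
Proof.
rewrite !(@diffopE (size A)) ?size_scale_leq // scaler_sumr.
by apply: eq_bigr => i _; rewrite coefZ scalerA.
Qed.

Lemma diffopMX A f : diffop (A * 'X) f = diffop A f^`().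
Proof.
have szX : (size (A * 'X)%R <= (size A).+1)%N.
  by apply: leq_trans (size_polyMleq _ _) _; rewrite size_polyX addn2.
rewrite (diffopE _ szX) big_ord_recl coefMX scale0r add0r.
by apply: eq_bigr => i _; rewrite lift0 coefMX derivSn.
Qed.

Lemma diffop1 f : diffop 1 f = f.
Proof. by rewrite /diffop size_poly1 big_ord1 coef1 scale1r. Qed.

Lemma diffop_deriv A f : diffop A f^`() = (diffop A f)^`().
Proof.
by rewrite /diffop raddf_sum; apply: eq_bigr => i _ /=; rewrite derivZ -derivSn derivnS.
Qed.

(** Composition of operators becomes multiplication of symbols, so iterates of phi(D) are handled by
    polynomial algebra. *)
Lemma diffopM A B f : diffop (A * B) f = diffop A (diffop B f).
Proof.
elim/poly_ind: A => [|A c IH] in f *; first by rewrite mul0r !diffop0.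
rewrite mulrDl mulrAC !diffopD !diffopMX {}IH -diffop_deriv.
by rewrite -[c%:P]mulr1 !mul_polyC -scalerAl mul1r !diffopZ diffop1.
Qed.

Lemma diffopXn k f : diffop 'X^k f = f^`(k).
Proof.
elim: k => [|k IH] in f *; first by rewrite expr0 diffop1.
by rewrite exprSr diffopMX IH derivSn.
Qed.

Lemma size_derivn_leq f k : (size f^`(k) <= size f)%N.
Proof.
elim: k => [|k IH]; rewrite ?derivn0 // derivnS; apply: leq_trans IH.
have [->|?] := eqVneq f^`(k) 0; first by rewrite deriv0.
by rewrite ltnW // lt_size_deriv.
Qed.

Lemma size_diffop A f : (size (diffop A f) <= size f)%N.
Proof.
apply: leq_trans (size_sum _ _ _) _; apply/bigmax_leqP => i _.
exact: leq_trans (size_scale_leq _ _) (size_derivn_leq _ _).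
Qed.

Lemma coef_diffop_top A f d :
  (size f <= d.+1)%N -> (diffop A f)`_d = A`_0 * f`_d.
Proof.
move=> szf; rewrite (diffopE _ (leqnSn _)) coef_sum big_ord_recl coefZ derivn0.
rewrite big1 ?addr0 // => i _; rewrite coefZ coef_derivn [f`__]nth_default ?mul0rn ?mulr0 //=.
by rewrite (leq_trans szf) // ltnS leq_addl.
Qed.

(* The binomial expansion, reindexed by a range that does not depend on [m]. *)
Lemma diffop_expr1DX2 N A f m : (size f <= N)%N ->
  diffop ((1 + 'X^2 * A) ^+ m) f
    = \sum_(j < N) 'C(m, j)%:R *: diffop (A ^+ j) f^`(j.*2).
Proof.
move=> szf; rewrite exprDn.
rewrite (big_morph (diffop^~ f) (fun A B => diffopD A B f) (diffop0 f)).
rewrite (eq_bigr (fun j : 'I_m.+1 => 'C(m, j)%:R *: diffop (A ^+ j) f^`(j.*2))).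
  apply: (sum_ord_support (F := fun j => 'C(m, j)%:R *: diffop (A ^+ j) f^`(j.*2))).
    by move=> j ltj; rewrite bin_small ?scale0r.
  move=> j lej; rewrite derivn_poly0; last first.
    by apply: leq_trans szf (leq_trans lej _); rewrite -addnn leq_addr.
  have := size_diffop (A ^+ j) 0; rewrite size_poly0 leqn0 size_poly_eq0.
  by move=> /eqP ->; rewrite scaler0.
move=> j _; rewrite expr1n mul1r -scaler_nat diffopZ; congr (_ *: _).
by rewrite exprMn -exprM mulrC diffopM diffopXn mul2n.
Qed.
End DiffOp.

Lemma phiD_diffop (R : realType) (alpha : nat -> R) (f : {poly R}) N :
  (size f <= N)%N -> phiD alpha f = diffop (\poly_(i < N) alpha i) f.
Proof.
move=> szf; rewrite (@diffopE _ N) ?size_poly //.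
rewrite (eq_bigr (fun i : 'I_N => alpha i *: f^`(i))); last first.
  by move=> i _; rewrite coef_poly ltn_ord.
apply: (sum_ord_support (F := fun i => alpha i *: f^`(i))) => i lei.
  by rewrite derivn_poly0 ?scaler0.
by rewrite derivn_poly0 ?scaler0 // (leq_trans szf).
Qed.

(** One truncation order serves all iterates, because phi(D) never raises the degree. *)
Lemma iter_phiD (R : realType) (alpha : nat -> R) (f : {poly R}) N m :
    (size f <= N)%N ->
  iter m (phiD alpha) f = diffop ((\poly_(i < N) alpha i) ^+ m) f.
Proof.
move=> szf; elim: m => [|m IH]; rewrite ?expr0 ?diffop1 //= exprS diffopM IH.
by rewrite (@phiD_diffop _ _ _ N) // (leq_trans (size_diffop _ _)).
Qed.

(** Truncation of exp(a x), whose operator is translation by [a] (Taylor's formula). *)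
Definition exp_trunc (F : fieldType) (a : F) N := \poly_(i < N) (a ^+ i / i`!%:R).

Lemma horner_exp_trunc (F : numFieldType) (a : F) N (f : {poly F}) x :
  (size f <= N)%N -> (diffop (exp_trunc a N) f).[x] = f.[x + a].
Proof.
move=> szf; rewrite (@diffopE _ N) ?size_poly // nderiv_taylor; last exact: mulrC.
rewrite horner_sum [RHS](sum_ord_support
  (F := fun i => f^`N(i).[x] * a ^+ i) (b := N)); first 1 last.
- by move=> i lei; rewrite nderivn_poly0 ?horner0 ?mul0r.
- by move=> i lei; rewrite nderivn_poly0 ?horner0 ?mul0r // (leq_trans szf).
apply: eq_bigr => i _; rewrite coef_poly ltn_ord hornerZ nderivn_def hornerMn.
by rewrite -mulr_natr mulrC mulrA -[RHS]mulr1; field; rewrite pnatr_eq0 -lt0n fact_gt0.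
Qed.

Lemma horner_exp_trunc_expr (F : numFieldType) (a : F) N (f : {poly F}) m x :
  (size f <= N)%N -> (diffop (exp_trunc a N ^+ m) f).[x] = f.[x + a *+ m].
Proof.
move=> szf; elim: m => [|m IH] in x *; first by rewrite expr0 diffop1 mulr0n addr0.
rewrite exprS diffopM horner_exp_trunc; last exact: leq_trans (size_diffop _ _) szf.
by rewrite IH mulrS addrA.
Qed.

(** * Rescaling by s = sqrt m and the Hermite limit *)

Section Rescaling.
Variable F : numFieldType.
Implicit Types (f A : {poly F}) (s y : F).

(** The indeterminate stands for 1/s: this is s^-d f(s y), with [d] a bound on the degree of [f]. *)
Definition rescale f d y := \sum_(k < d.+1) (f`_k * y ^+ k) *: 'X^(d - k).

Lemma horner_rescale f d y s : s != 0 -> (size f <= d.+1)%N ->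
  f.[s * y] = s ^+ d * (rescale f d y).[s^-1].
Proof.
move=> s_neq0 szf; rewrite (horner_coef_wide _ szf) horner_sum mulr_sumr.
apply: eq_bigr => k _; rewrite hornerZ hornerXn exprMn exprVn.
by rewrite expfB_cond ?(negPf s_neq0) ?leq_ord // invf_div; field; rewrite !expf_neq0.
Qed.

Lemma rescale_at0 f d y : (rescale f d y).[0] = f`_d * y ^+ d.
Proof.
rewrite /rescale big_ord_recr /= subnn expr0 hornerD hornerZ hornerC mulr1.
rewrite horner_sum big1 ?add0r // => k _.
by rewrite hornerZ hornerXn expr0n subn_eq0 leqNgt ltn_ord mulr0.
Qed.

(** With X = 1/s and s^2 = m this is m(m-1)...(m-j+1) / m^j. *)
Definition ffact_rescale j : {poly F} := \prod_(i < j) (1 - i%:R *: 'X^2).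

Lemma horner_ffact_rescale m j s : s ^+ 2 = m%:R -> s != 0 ->
  'C(m, j)%:R = s ^+ j.*2 * (j`!%:R^-1 * (ffact_rescale j).[s^-1]).
Proof.
move=> s2 s_neq0.
suff H : (m ^_ j)%:R = s ^+ j.*2 * (ffact_rescale j).[s^-1].
  rewrite mulrCA -H -bin_ffact natrM mulrCA mulVf ?mulr1 //.
  by rewrite pnatr_eq0 -lt0n fact_gt0.
elim: j => [|j IH]; first by rewrite ffactn0 /ffact_rescale big_ord0 hornerC mulr1.
rewrite ffactnSr natrM IH /ffact_rescale big_ord_recr /= hornerM.
(* For [m < j] the subtraction [m - j] is truncated, but both sides already vanish by induction. *)
case: (leqP j m) => [lejm|ltmj]; last first.
  have := IH; rewrite ffact_small // => /esym/eqP.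
  by rewrite mulf_eq0 expf_eq0 (negPf s_neq0) andbF => /eqP ->; rewrite !(mul0r, mulr0).
rewrite natrB // -s2; set P := (\prod_(i < j) _).[_].
rewrite hornerD hornerN hornerZ hornerXn hornerC doubleS !exprS expr0.
by field.
Qed.

(** A single polynomial in 1/s valid for all m. The guard keeps [n - j.*2] an honest subtraction;
    the omitted terms have zero derivatives when [f] has degree at most [n]. *)
Definition diffop_rescale A f n y :=
  \sum_(j < n.+1 | (j.*2 <= n)%N)
    j`!%:R^-1 *: (ffact_rescale j * rescale (diffop (A ^+ j) f^`(j.*2)) (n - j.*2) y).

Lemma size_derivn_sub f n k : (size f <= n.+1)%N -> (k <= n)%N ->
  (size f^`(k) <= (n - k).+1)%N.
Proof.
move=> szf lekn; apply/leq_sizeP => i lti; rewrite coef_derivn nth_default ?mul0rn //.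
by apply: leq_trans szf _; lia.
Qed.

(** In the j-th binomial term the coefficient supplies s^(2j) and the derivative, of degree at most
    n-2j, supplies s^(n-2j): every term carries s^n. *)
Lemma horner_diffop_rescale A f n y m s :
    (size f <= n.+1)%N -> s ^+ 2 = m%:R -> s != 0 ->
  (diffop ((1 + 'X^2 * A) ^+ m) f).[s * y]
    = s ^+ n * (diffop_rescale A f n y).[s^-1].
Proof.
move=> szf s2 s_neq0; rewrite (diffop_expr1DX2 _ _ szf) !horner_sum mulr_sumr.
rewrite [RHS]big_mkcond; apply: eq_bigr => j _; case: ifPn => [le2jn|]; last first.
  rewrite -ltnNge => ltn2j.
  have := size_diffop (A ^+ j) f^`(j.*2).
  rewrite derivn_poly0 ?(leq_trans szf) // size_poly0 leqn0 size_poly_eq0.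
  by move=> /eqP ->; rewrite scaler0 horner0.
rewrite !hornerZ hornerM (horner_ffact_rescale j s2 s_neq0).
rewrite (@horner_rescale _ (n - j.*2)) //; last first.
  exact: leq_trans (size_diffop _ _) (size_derivn_sub szf le2jn).
have -> : s ^+ n = s ^+ j.*2 * s ^+ (n - j.*2) by rewrite -exprD subnKC.
ring.
Qed.

(** At 1/s = 0 the binomial coefficient leaves 1/j!, only the constant term of [A ^+ j] reaches the
    top coefficient, and the sum is the expansion of [hermiteE]. *)
Lemma diffop_rescale_at0 A f n y : (size f <= n.+1)%N ->
  (diffop_rescale A f n y).[0] = f`_n * (hermite A`_0 n).[y].
Proof.
move=> szf; rewrite hermiteE; last by move=> k; rewrite pnatr_eq0.
rewrite !horner_sum mulr_sumr big_mkcond; apply: eq_bigr => j _.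
rewrite !hornerZ derivnXn; case: ifPn => [le2jn|]; last first.
  by rewrite -ltnNge => lt; rewrite ffact_small // mulr0n horner0 !mulr0.
rewrite hornerM rescale_at0 /ffact_rescale horner_prod big1 ?mul1r; last first.
  by move=> i _; rewrite hornerD hornerN hornerZ hornerXn hornerC expr0n mulr0 subr0.
rewrite (coef_diffop_top _ (size_derivn_sub szf le2jn)) coef_derivn subnKC //.
rewrite hornerMn hornerXn -[_ *+ n ^_ _]mulr_natr -[_ *+ n ^_ _]mulr_natr.
rewrite (_ : (A ^+ j)`_0 = A`_0 ^+ j); last by rewrite -!horner_coef0 horner_exp.
ring.
Qed.
End Rescaling.

(** * Sign changes of phi(D)^m f for large m *)

Lemma poly_lt0_near0 (R : realType) (p : {poly R}) : p.[0] < 0 ->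
  exists2 d, 0 < d & forall u, 0 < u < d -> p.[u] < 0.
Proof.
move=> p0; have [|d d_gt0 dP] := @poly_cont _ 0 p (- p.[0]); first by rewrite oppr_gt0.
exists d => // u /andP[u_gt0 ltud]; have := dP u.
rewrite subr0 gtr0_norm // => /(_ ltud); rewrite ltr_norml => /andP[_]; lra.
Qed.

Lemma polys_lt0_near0 (R : realType) n (p : nat -> {poly R}) :
    (forall i, (i < n)%N -> (p i).[0] < 0) ->
  exists2 d, 0 < d & forall i u, (i < n)%N -> 0 < u < d -> (p i).[u] < 0.
Proof.
elim: n => [|n IH] pP; first by exists 1.
have [|d d_gt0 dP] := IH; first by move=> i lti; apply: pP; apply: ltnW.
have [d' d'_gt0 d'P] := poly_lt0_near0 (pP n (ltnSn n)).
exists (Num.min d d'); first by rewrite lt_min d_gt0.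
move=> i u; rewrite ltnS leq_eqVlt lt_min => lei /and3P[u0 ud ud'].
case/predU1P: lei => [->|lti]; first by apply: d'P; rewrite u0.
by apply: dP; rewrite ?u0.
Qed.

Lemma diffop_alternating (R : realType) (A f : {poly R}) :
    f != 0 -> A`_0 < 0 ->
  exists m0 : nat, (0 < m0)%N /\ forall m, (m0 <= m)%N ->
    exists y, alternating (diffop ((1 + 'X^2 * A) ^+ m) f) (size f).-1 y.
Proof.
move=> f_neq0 A0; set n := (size f).-1.
have szf : size f = n.+1 by rewrite prednK // size_poly_gt0.
have [y alt_y] := alternating_hermite n A0.
pose p i := diffop_rescale A f n (y i).
(* Each sign change is the negativity of one product, which at 0 is a squared leading coefficient
   times a negative product of Hermite values. *)
have [i lti|d d_gt0 dP] := @polys_lt0_near0 _ n (fun i => p i * p i.+1).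
  have [_] := alt_y _ lti; rewrite hornerM !diffop_rescale_at0 ?szf // mulrACA.
  move=> lt0; rewrite pmulr_rlt0 // -expr2 exprn_even_gt0 //=.
  by rewrite -/(lead_coef f) lead_coef_eq0.
(* Then m > d^-2, that is, 1/s < d. *)
exists (Num.bound (d ^- 2)).+1; split=> // m lem.
pose s : R := Num.sqrt m%:R.
have m_gt0 : 0 < m%:R :> R by rewrite ltr0n (leq_trans _ lem).
have s_gt0 : 0 < s by rewrite sqrtr_gt0.
have s2 : s ^+ 2 = m%:R by rewrite sqr_sqrtr // ltW.
have ltsd : 0 < s^-1 < d.
  rewrite invr_gt0 s_gt0 /= invf_plt ?posrE //.
  rewrite -(ltr_pXn2r (n := 2)) ?nnegrE ?invr_ge0 ?(ltW d_gt0) ?(ltW s_gt0) //.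
  rewrite s2 exprVn; apply: lt_trans (archi_boundP _) _.
    by rewrite invr_ge0 exprn_ge0 // ltW.
  by rewrite ltr_nat.
exists (fun i => s * y i) => i lti; have [lty _] := alt_y _ lti.
rewrite ltr_pM2l //; split=> //.
rewrite !(@horner_diffop_rescale _ _ _ n) ?szf ?gt_eqF //.
rewrite mulrACA pmulr_rlt0 ?mulr_gt0 ?exprn_gt0 //.
by have := dP i _ lti ltsd; rewrite hornerM.
Qed.

Lemma iter_phiD_alternating (R : realType) (alpha : nat -> R) (f : {poly R}) :
    alpha 0%N != 0 -> 2 * alpha 0%N * alpha 2%N - alpha 1%N ^+ 2 < 0 -> f != 0 ->
  exists m0 : nat, (0 < m0)%N /\ forall m, (m0 <= m)%N ->
    exists y, alternating (iter m (phiD alpha) f) (size f).-1 y.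
Proof.
move=> a0 disc f_neq0; set n := size f.
(* At least three coefficients are kept, so that [alpha 0], [alpha 1] and [alpha 2] are all visible
   in [P], however small [f] is. *)
pose N := n.+3; have lenN : (n <= N)%N by rewrite !leqW.
(* This choice cancels the linear term of [Q]. *)
pose t := - alpha 1%N / alpha 0%N.
pose P := \poly_(i < N) alpha i.
pose Q := (alpha 0%N)^-1 *: (exp_trunc t N * P).
have Q0 : Q`_0 = 1.
  by rewrite coefZ coefM big_ord1 !coef_poly /= expr0 divr1; field.
have Q1 : Q`_1 = 0.
  rewrite coefZ coefM !big_ord_recr big_ord0 !coef_poly /= /t.
  by rewrite subn0 subnn expr0 !divr1; field.
have Q2 : Q`_2 < 0.
  have -> : Q`_2 = (2 * alpha 0%N * alpha 2%N - alpha 1%N ^+ 2) / (2 * alpha 0%N ^+ 2).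
    rewrite coefZ coefM !big_ord_recr big_ord0 !coef_poly /= /t.
    rewrite subn0 subnn -[(2 - 1)%N]/1%N (_ : 2`! = 2%N) // expr0 !divr1.
    by field.
  by rewrite pmulr_llt0 // invr_gt0 mulr_gt0 // exprn_even_gt0.
pose V := drop_poly 2 Q.
have QE : Q = 1 + 'X^2 * V.
  rewrite -{1}(poly_take_drop 2 Q) [_ * 'X^2]mulrC; congr (_ + _).
  apply/polyP => -[|[|i]]; rewrite coef_take_poly coef1 //=.
have V0 : V`_0 < 0 by rewrite coef_drop_poly.
have [m0 [m0_gt0 m0P]] := diffop_alternating f_neq0 V0.
exists m0; split=> // m /m0P[y alt_y].
(* The m-th power of the exponential factor translates by [t *+ m], and the scalar alpha_0^-m enters
   each product squared. *)
exists (fun i => y i + t *+ m) => i lti; have [lty ltp] := alt_y i lti.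
rewrite ltrD2r; split=> //; move: ltp.
rewrite (iter_phiD _ m lenN) -/P -!(horner_exp_trunc_expr t m _ (N := N)); last 2 first.
- exact: leq_trans (size_diffop _ _) lenN.
- exact: leq_trans (size_diffop _ _) lenN.
rewrite -QE -!diffopM -exprMn.
have -> : Q ^+ m = (alpha 0%N ^- m) *: (exp_trunc t N * P) ^+ m.
  by rewrite /Q exprZn exprVn.
rewrite diffopZ !hornerZ mulrACA pmulr_rlt0 // -expr2 exprn_even_gt0 //=.
by rewrite invr_eq0 expf_neq0.
Qed.

(** * The converse: quadratics with nonreal zeros *)

Lemma phiD_quadratic (R : realType) (alpha : nat -> R) (a b c : R) :
  phiD alpha (a *: 'X^2 + b *: 'X + c%:P)
    = (alpha 0%N * a) *: 'X^2 + (alpha 0%N * b + 2 * alpha 1%N * a) *: 'X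
      + (alpha 0%N * c + alpha 1%N * b + 2 * alpha 2%N * a)%:P.
Proof.
have sz : (size (a *: 'X^2 + b *: 'X + c%:P)%R <= 3)%N.
  by apply/leq_sizeP => -[|[|[|i]]] // _; rewrite !coefE /=; ring.
rewrite (phiD_diffop alpha sz) (@diffopE _ 3) ?size_poly //.
rewrite !big_ord_recr big_ord0 !coef_poly /= !derivE.
by apply/polyP => -[|[|[|i]]]; rewrite !coefE /=; ring.
Qed.

Lemma ZC_quadratic_neq0 (R : realType) (a b c : R) :
  a != 0 -> b ^+ 2 < 4 * a * c -> ZC (a *: 'X^2 + b *: 'X + c%:P) != 0%N.
Proof.
move=> a_neq0 disc; set g := _ + _.
have sz : size g = 3%N.
  rewrite /g -addrA size_polyDl size_scale ?size_polyXn // ltnS.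
  apply/leq_sizeP => -[|[|i]] // _; rewrite !coefE /=; ring.
have g_neq0 : g != 0 by rewrite -size_poly_eq0 sz.
rewrite /ZC (negPf g_neq0) -lt0n -has_count.
have [z rz] : exists z, root (map_poly (real_complex R) g) z.
  by apply/closed_rootP; rewrite size_map_poly sz.
apply/hasP; exists z; first by rewrite root_czeros.
apply: contraTneq rz => Imz.
have -> : z = real_complex R (complex.Re z) by case: z Imz => x y /= ->.
rewrite fmorph_root; apply/rootP; set x := complex.Re z.
rewrite /g !hornerD !hornerZ hornerXn hornerX hornerC => gx0.
(* Completing the square: a real zero would make this square negative. *)
have : (2 * a * x + b) ^+ 2 = 4 * a * (a * x ^+ 2 + b * x + c) - (4 * a * c - b ^+ 2).
  by ring.
rewrite gx0 mulr0 sub0r => sq; have := sqr_ge0 (2 * a * x + b).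
by rewrite sq oppr_ge0 leNgt subr_gt0 disc.
Qed.

Lemma iter_phiD_quadratic (R : realType) (alpha : nat -> R) m :
    alpha 0%N != 0 -> 0 <= 2 * alpha 0%N * alpha 2%N - alpha 1%N ^+ 2 ->
  ZC (iter m (phiD alpha) ('X^2 + 1)) != 0%N.
Proof.
move=> a0 disc.
suff [a [b [c [a_neq0 lt_abc ->]]]] : exists a b c, [/\ a != 0,
    b ^+ 2 < 4 * a * c & iter m (phiD alpha) ('X^2 + 1) = a *: 'X^2 + b *: 'X + c%:P].
  exact: ZC_quadratic_neq0.
elim: m => [|m [a [b [c [a_neq0 lt_abc IH]]]]].
  exists 1, 0, 1; split; rewrite ?oner_eq0 //=; first by lra.
  by rewrite scale1r scale0r addr0.
exists (alpha 0%N * a), (alpha 0%N * b + 2 * alpha 1%N * a),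
  (alpha 0%N * c + alpha 1%N * b + 2 * alpha 2%N * a).
split; first by rewrite mulf_neq0.
  rewrite -subr_gt0.
  set D := _ - _.
  (* The mixed terms in [a * b] cancel, leaving a positive summand from the induction hypothesis and
     a nonnegative one from [disc]. *)
  have -> : D = alpha 0%N ^+ 2 * (4 * a * c - b ^+ 2)
      + 4 * a ^+ 2 * (2 * alpha 0%N * alpha 2%N - alpha 1%N ^+ 2) by rewrite /D; ring.
  apply: ltr_wpDr; first by rewrite mulr_ge0 // mulr_ge0 ?sqr_ge0 ?ler0n.
  by rewrite mulr_gt0 ?subr_gt0 // exprn_even_gt0.
by rewrite iterS IH phiD_quadratic.
Qed.

(** * The degenerate case alpha_0 = 0, and the equivalence *)

(** Every surviving term differentiates at least once, so iterating phi(D) eventually kills any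
    polynomial. *)
Lemma size_phiD0 (R : realType) (alpha : nat -> R) (f : {poly R}) :
  alpha 0%N = 0 -> (size (phiD alpha f) <= (size f).-1)%N.
Proof.
move=> a0; rewrite (phiD_diffop alpha (leqnSn _)).
apply/leq_sizeP => i; rewrite leq_eqVlt => /predU1P[<-|].
  by rewrite coef_diffop_top ?coef_poly ?a0 ?mul0r //; apply: leqSpred.
move=> lti; rewrite nth_default //; apply: leq_trans (size_diffop _ _) _.
by apply: leq_trans (leqSpred _) lti.
Qed.

Lemma size_iter_phiD0 (R : realType) (alpha : nat -> R) (f : {poly R}) m :
  alpha 0%N = 0 -> (size (iter m (phiD alpha) f) <= size f - m)%N.
Proof.
move=> a0; elim: m => [|m IH]; first by rewrite subn0.
apply: leq_trans (size_phiD0 _ a0) _; rewrite subnS.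
by rewrite -!subn1 leq_sub2r.
Qed.

Theorem mainTheorem4 (R : realType) (alpha : nat -> R) :
  (forall f : {poly R}, exists m0 : nat, (0 < m0)%N /\
     forall m : nat, (m0 <= m)%N -> ZC (iter m (phiD alpha) f) = 0%N)
  <->
  (alpha 0%N = 0 \/ 2 * alpha 0%N * alpha 2%N - alpha 1%N ^+ 2 < 0).
Proof.
split=> [real_zeros|cond f].
  have [->|a0] := eqVneq (alpha 0%N) 0; [by left | right].
  rewrite ltNge; apply/negP => disc.
  have [m0 [_ /(_ m0 (leqnn _)) /eqP]] := real_zeros ('X^2 + 1).
  by rewrite (negPf (iter_phiD_quadratic m0 a0 disc)).
have [a0|a0] := eqVneq (alpha 0%N) 0.
  (* From here on the iterate is 0, where [ZC] is 0 by convention; the successor keeps the bound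
     positive even for [f = 0]. *)
  exists (size f).+1; split=> // m /ltnW ltm.
  have := size_iter_phiD0 f m a0; rewrite (eqP ltm) leqn0 size_poly_eq0.
  by rewrite /ZC => ->.
have [->|f_neq0] := eqVneq f 0.
  exists 1%N; split=> // m _; rewrite (iter_phiD alpha m (leqnn _)).
  have := size_diffop ((\poly_(i < size (0 : {poly R})) alpha i) ^+ m) 0.
  by rewrite size_poly0 leqn0 size_poly_eq0 /ZC => ->.
have disc : 2 * alpha 0%N * alpha 2%N - alpha 1%N ^+ 2 < 0.
  by case: cond => // a0'; rewrite a0' eqxx in a0.
have [m0 [m0_gt0 m0P]] := iter_phiD_alternating a0 disc f_neq0.
exists m0; split=> // m /m0P[y]; apply: ZC_alternating.
rewrite prednK ?size_poly_gt0 // (iter_phiD alpha m (leqnn _)).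
exact: size_diffop.
Qed.
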